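(* Let $\mathcal H=(V,E)$ be a locally finite simple hypergraph that is $r$-uniform and linear. Let $x,y\in V$ with $x\sim_{\mathcal H}y$. Then the function $\alpha\mapsto\kappa_{\alpha}^{\mathcal H}(x,y)$ is concave and piecewise linear over $[0,1]$ with at most $3$ linear parts. Furthermore, $\kappa_{\alpha}^{\mathcal H}(x,y)$ is linear (as a function of $\alpha$) on the intervals $$\left[0,\frac{1}{\operatorname{lcm}\left(d_x^{\mathcal H},d_y^{\mathcal H}\right)(r-1)+1}\right]\quad\text{and}\quad\left[\frac{1}{\max\left(d_x^{\mathcal H},d_y^{\mathcal H}\right)(r-1)+1},1\right].$$ Thus, if moreover $d_x^{\mathcal H}=d_y^{\mathcal H}$, then $\alpha\mapsto\kappa_{\alpha}^{\mathcal H}(x,y)$ has at most two linear parts.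
   Context: A hypergraph $\mathcal H=(V,E)$ consists of a vertex set $V$ and a set $E$ of finite subsets of $V$ (hyperedges). It is simple if $|e|\ge 2$ for every $e\in E$ and, for distinct $e,f\in E$, neither $e\subseteq f$ nor $f\subseteq e$. It is locally finite if each vertex belongs to only finitely many hyperedges; every hyperedge is finite. It is $r$-uniform if $|e|=r$ for all $e\in E$, and linear if any two distinct hyperedges have at most one vertex in common. The incidence degree of $x\in V$ is $d_x^{\mathcal H}:=\#\{e\in E: x\in e\}$. Two distinct vertices are adjacent, $x\sim_{\mathcal H}y$, if they lie in a common hyperedge. A hyperpath joining $u,v\in V$ is a finite sequence $(e_1,\dots,e_l)$ of distinct hyperedges with $u\in e_1$, $v\in e_l$ and $e_j\cap e_{j+1}\ne\varnothing$ for $1\le j\le l-1$. The distance $d_{\mathcal H}(u,v)$ is the minimum number $l$ of hyperedges in a hyperpath joining $u$ and $v$ ($\infty$ if none exists), and $d_{\mathcal H}(u,u)=0$. For finitely supported probability measures $\mu_1,\mu_2$ on $V$, the $1$-Wasserstein distance is $$W_1^{\mathcal H}(\mu_1,\mu_2):=\inf_{\pi}\sum_{u\in V}\sum_{v\in V}d_{\mathcal H}(u,v)\,\pi(u,v)$$ (with $\infty\cdot 0=0$), where the infimum is over all $\pi:V\times V\to[0,1]$ with $\sum_{w}\pi(u,w)=\mu_1(u)$ and $\sum_{w}\pi(w,v)=\mu_2(v)$ for all $u,v\in V$. For $x\in V$ and idleness $\alpha\in[0,1]$, the probability measure $\mu_x^\alpha$ on $V$ is defined by $\mu_x^\alpha(x)=\alpha$;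 $\mu_x^\alpha(z)=\frac{1-\alpha}{d_x^{\mathcal H}}\sum_{e\in E,\ e\supseteq\{x,z\}}\frac{1}{|e|-1}$ if $z\sim_{\mathcal H}x$; and $\mu_x^\alpha(z)=0$ otherwise. The $\alpha$-Ollivier--Ricci curvature is $$\kappa_\alpha^{\mathcal H}(x,y):=1-\frac{W_1^{\mathcal H}(\mu_x^\alpha,\mu_y^\alpha)}{d_{\mathcal H}(x,y)}.$$ ''Linear'' on an interval means affine in $\alpha$ there; ''piecewise linear over $[0,1]$ with at most $k$ linear parts'' means that $[0,1]$ can be divided into at most $k$ consecutive closed intervals on each of which the function is affine. *)

(* Defs.v *)
From HB Require Import structures.
From mathcomp Require Import all_boot all_order all_algebra finmap.
From mathcomp Require Import all_classical all_reals all_analysis.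

Set Implicit Arguments.
Unset Strict Implicit.
Unset Printing Implicit Defensive.

Import Order.TTheory GRing.Theory Num.Theory.
Import numFieldNormedType.Exports.

Local Open Scope classical_set_scope.
Local Open Scope ring_scope.

(* The vertex set is the whole (possibly infinite) type [V]; a hypergraph on
   [V] is its set [E] of hyperedges. *)
Definition hypergraph (V : choiceType) := set {fset V}.

Definition simple_hypergraph (V : choiceType) (E : hypergraph V) : Prop :=
  (forall e, E e -> (2 <= #|` e|)%N) /\
  (forall e f, E e -> E f -> e != f -> ~~ (e `<=` f)%fset /\ ~~ (f `<=` e)%fset).

Definition locally_finite (V : choiceType) (E : hypergraph V) : Prop :=
  forall x : V, finite_set [set e | E e /\ x \in e].

Definition uniform_hypergraph (V : choiceType) (r : nat) (E : hypergraph V) :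
    Prop :=
  forall e, E e -> #|` e| = r.

Definition linear_hypergraph (V : choiceType) (E : hypergraph V) : Prop :=
  forall e f, E e -> E f -> e != f -> (#|` (e `&` f)%fset| <= 1)%N.

(* Meaningful only if finitely many hyperedges contain [x]: [fset_set] of an
   infinite set is empty. *)
Definition hdegree (V : choiceType) (E : hypergraph V) (x : V) : nat :=
  #|` fset_set [set e | E e /\ x \in e]|.

Definition hadjacent (V : choiceType) (E : hypergraph V) (x y : V) : Prop :=
  x != y /\ exists e, [/\ E e, x \in e & y \in e].

(* The endpoint conditions exclude the empty sequence, since the default value
   of [head] and [last] is the empty hyperedge. *)
Definition hyperpath (V : choiceType) (E : hypergraph V) (u v : V) :
    set (seq {fset V}) :=
  [set p | [/\ uniq p, (forall e, e \in p -> E e),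
      u \in head fset0 p, v \in last fset0 p &
      sorted (fun e f : {fset V} => (e `&` f)%fset != fset0) p]].

Definition hdist (R : realType) (V : choiceType) (E : hypergraph V) (u v : V) :
    \bar R :=
  if u == v then 0%E
  else ereal_inf [set ((size p)%:R)%:E | p in hyperpath E u v].

Definition coupling (R : realType) (V : choiceType) (mu1 mu2 : V -> R) :
    set (V -> V -> R) :=
  [set pi | [/\ forall u v, 0 <= pi u v <= 1,
      forall u, (\esum_(w in [set: V]) (pi u w)%:E)%E = (mu1 u)%:E &
      forall v, (\esum_(w in [set: V]) (pi w v)%:E)%E = (mu2 v)%:E]].

(* In [\bar R] the product of [+oo] and [0] is [0]. *)
Definition wasserstein1 (R : realType) (V : choiceType) (E : hypergraph V)
    (mu1 mu2 : V -> R) : \bar R :=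
  ereal_inf [set (\esum_(u in [set: V]) \esum_(v in [set: V])
                    (hdist R E u v * (pi u v)%:E))%E | pi in coupling mu1 mu2].

Definition rw_measure (R : realType) (V : choiceType) (E : hypergraph V)
    (alpha : R) (x z : V) : R :=
  if z == x then alpha
  else if `[< hadjacent E z x >] then
    (1 - alpha) / (hdegree E x)%:R *
      \sum_(e \in [set e | E e /\ ([fset x; z] `<=` e)%fset])
        (#|` e|%:R - 1 : R)^-1
  else 0.

Definition ollivier_ricci (R : realType) (V : choiceType) (E : hypergraph V)
    (x y : V) (alpha : R) : \bar R :=
  (1 - wasserstein1 E (rw_measure E alpha x) (rw_measure E alpha y)
       / hdist R E x y)%E.

Definition concave_function (R : realType) (D : set R) (f : R -> R) : Prop :=
  @convex_function R R^o D (fun a => - f a).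

Definition affine_on (R : realType) (I : set R) (f : R -> R) : Prop :=
  exists a b : R, forall t, I t -> f t = a * t + b.

Definition piecewise_linear01 (R : realType) (k : nat) (f : R -> R) : Prop :=
  exists (m : nat) (c : nat -> R),
    [/\ (m <= k)%N, c 0%N = 0, c m = 1 &
      forall i, (i < m)%N -> c i < c i.+1 /\ affine_on `[c i, c i.+1] f].

(* Main.v *)
Require Import Defs.
From mathcomp Require Import all_boot all_order all_algebra finmap.
From mathcomp Require Import ring lra zify.
From mathcomp Require Import all_classical all_reals all_analysis.

(* Linearity and uniformity turn the random walk of the hypergraph into the one
   of its adjacency graph, with degrees D_x = d_x (r - 1) and
   D_y = d_y (r - 1). By Kantorovich duality the Wasserstein distance is a
   maximum over integer-valued 1-Lipschitz potentials f, and f x - f y is one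
   of 1, 0, -1. Hence W_1 is the maximum of three affine functions
   j alpha + (1 - alpha) k_j / L with L = lcm(D_x, D_y) and k_j an integer.
   Rounding half the sum of two potentials down and up gives
   k_1 + k_-1 <= 2 k_0, so that in the variable alpha / (1 - alpha) the breaks
   are at (k_-1 - k_0) / L <= (k_0 - k_1) / L. Being multiples of 1 / L, they
   avoid ]0, 1 / L[, and pushing a potential down outside the larger of the two
   spheres shows that the second one is at most 1 / max(D_x, D_y). *)

Set Implicit Arguments.
Unset Strict Implicit.
Unset Printing Implicit Defensive.

Import Order.TTheory GRing.Theory Num.Theory.

Local Open Scope ring_scope.

(** * A weighted marriage theorem *)

Definition rel_image (T : finType) (e : rel T) (A : {set T}) : {set T} :=
  [set v | [exists u in A, e u v]].

Lemma rel_imageU (T : finType) (e : rel T) (A B : {set T}) :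
  rel_image e (A :|: B) = rel_image e A :|: rel_image e B.
Proof.
apply/setP => v; rewrite !inE; apply/exists_inP/orP.
  by case=> u; rewrite inE => /orP[] uA uv; [left | right];
    apply/exists_inP; exists u.
by case=> /exists_inP[u uA uv]; exists u; rewrite // inE uA ?orbT.
Qed.

Lemma rel_imageS (T : finType) (e : rel T) (A B : {set T}) :
  A \subset B -> rel_image e A \subset rel_image e B.
Proof. by move=> /finset.setUidPr <-; rewrite rel_imageU finset.subsetUl. Qed.

Section Hall.
Variables (R : realFieldType) (T : finType) (e : rel T).
Implicit Types (mu nu : T -> R) (A S : {set T}).

Definition hall mu nu :=
  forall A, \sum_(u in A) mu u <= \sum_(v in rel_image e A) nu v.

(** Only the rows are exact; the columns become exact once the total masses agree. *)
Definition subcoupling mu nu (pi : T -> T -> R) :=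
  [/\ forall u v, 0 <= pi u v, forall u v, pi u v != 0 -> e u v,
      forall u, \sum_v pi u v = mu u & forall v, \sum_u pi u v <= nu v].

Lemma sum_restrict (B : {set T}) (P : pred T) mu :
  \sum_(u | P u) (if u \in B then mu u else 0) =
  \sum_(u | P u && (u \in B)) mu u.
Proof. by rewrite big_mkcondr. Qed.

Lemma sum_set_restrict A (B : {set T}) mu :
  \sum_(u in A) (if u \in B then mu u else 0) = \sum_(u in A :&: B) mu u.
Proof. by rewrite sum_restrict; apply: eq_bigl => u; rewrite inE. Qed.

Lemma ler_sum_subset A (B : {set T}) mu :
  (forall u, 0 <= mu u) -> A \subset B ->
  \sum_(u in A) mu u <= \sum_(u in B) mu u.
Proof.
move=> mu0 /fintype.subsetP AB; rewrite [leRHS](bigID (mem A)) /=.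
rewrite [X in _ <= X + _](eq_bigl (mem A)); first by rewrite lerDl sumr_ge0.
by move=> u; apply/andP/idP => [[]|] // uA; split=> //; exact: AB.
Qed.

Lemma sum_setU A (B : {set T}) mu :
  \sum_(u in A :|: B) mu u = \sum_(u in B) mu u + \sum_(u in A :\: B) mu u.
Proof.
rewrite (bigID (mem B)) /=; congr (_ + _); apply: eq_bigl => u; rewrite !inE.
  by case: (u \in B); rewrite ?orbT ?andbF.
by case: (u \in B); rewrite ?orbT ?andbF ?orbF ?andbT.
Qed.

(** A tight set splits the problem. On [S], use Hall's condition at [A :&: S]; off [S], use it at
    [A :|: S] and cancel the equal sums over [S] and its image. *)
Lemma hall_split mu nu S : (forall u, 0 <= nu u) -> hall mu nu ->
  \sum_(u in S) mu u = \sum_(v in rel_image e S) nu v ->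
  hall (fun u => if u \in S then mu u else 0)
       (fun v => if v \in rel_image e S then nu v else 0) /\
  hall (fun u => if u \in ~: S then mu u else 0)
       (fun v => if v \in ~: rel_image e S then nu v else 0).
Proof.
move=> nu0 H tS; split=> A; rewrite !sum_set_restrict.
  apply: le_trans (H _) _; apply: ler_sum_subset => //.
  by rewrite finset.subsetI !rel_imageS // (finset.subsetIl, finset.subsetIr).
have := H (A :|: S); rewrite rel_imageU !sum_setU tS lerD2l.
by rewrite -!finset.setDE.
Qed.

Definition nsupp (mu : T -> R) := #|[set u | mu u != 0]|.

Lemma nsupp_lt mu mu' a : mu a != 0 -> mu' a = 0 ->
  (forall u, mu u = 0 -> mu' u = 0) -> (nsupp mu' < nsupp mu)%N.
Proof.
move=> ma m'a sub; apply: proper_card; apply/properP; split.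
  by apply/fintype.subsetP => u; rewrite !inE; apply: contraNN => /eqP/sub ->.
by exists a; rewrite !inE ?m'a ?eqxx.
Qed.

Lemma nsupp_le mu mu' :
  (forall u, mu u = 0 -> mu' u = 0) -> (nsupp mu' <= nsupp mu)%N.
Proof.
move=> sub; apply: subset_leq_card.
by apply/fintype.subsetP => u; rewrite !inE; apply: contraNN => /eqP/sub ->.
Qed.

Lemma subcouplingD mu nu mu' nu' pi pi' :
  subcoupling mu nu pi -> subcoupling mu' nu' pi' ->
  subcoupling (fun u => mu u + mu' u) (fun u => nu u + nu' u)
    (fun u v => pi u v + pi' u v).
Proof.
move=> [p0 pe pr pc] [p0' pe' pr' pc']; split=> [u v|u v|u|v].
- exact: addr_ge0.
- have [->|/pe//] := eqVneq (pi u v) 0; rewrite add0r; exact: pe'.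
- by rewrite big_split /= pr pr'.
- by rewrite big_split /= lerD.
Qed.

Lemma sum_pred1 (P : pred T) a (t : R) :
  \sum_(u | P u) (if u == a then t else 0) = if P a then t else 0.
Proof.
case: ifP => Pa.
  rewrite (bigD1 a) //= eqxx big1 ?addr0 // => u /andP[_ /negbTE ->] //.
by rewrite big1 // => u Pu; case: eqP => // ua; rewrite -ua Pu in Pa.
Qed.

Lemma subcoupling_edge a b (t : R) : 0 <= t -> e a b ->
  subcoupling (fun u => if u == a then t else 0)
    (fun v => if v == b then t else 0)
    (fun u v => if (u == a) && (v == b) then t else 0).
Proof.
move=> t0 ab; split=> [u v|u v|u|v].
- by case: ifP.
- by case: ifP => [/andP[/eqP-> /eqP->]//|]; rewrite eqxx.
- case: (u == a) => /=; last by rewrite big1.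
  by rewrite sum_pred1.
- case: (v == b); under eq_bigr do rewrite ?andbF ?andbT; last by rewrite big1.
  by rewrite sum_pred1.
Qed.

Lemma subcoupling_eq mu nu mu' nu' pi : mu =1 mu' -> nu =1 nu' ->
  subcoupling mu nu pi -> subcoupling mu' nu' pi.
Proof. by move=> em en [? ? pr pc]; split=> // ?; rewrite -?em -?en. Qed.

(** Induction on the total size of the two supports: mass is pushed along one edge until a source or
    a target is exhausted, or until a set becomes tight and [hall_split] cuts the problem in two. *)
Theorem weighted_hall mu nu :
  (forall u, 0 <= mu u) -> (forall u, 0 <= nu u) -> hall mu nu ->
  exists pi, subcoupling mu nu pi.
Proof.
have [n] := ubnP (nsupp mu + nsupp nu)%N.
elim: n mu nu => // n IH mu nu; rewrite ltnS => len mu0 nu0 H.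
have [/existsP[a ma]|] := boolP [exists a, mu a != 0]; last first.
  move=> /existsPn z; exists (fun _ _ => 0); split=> //.
  - by move=> u v; rewrite eqxx.
  - by move=> u; rewrite big1 //; have := z u; rewrite negbK => /eqP.
  - by move=> v; rewrite big1.
have ma0 : 0 < mu a by rewrite lt_def ma mu0.
(* Hall's condition at [[set a]] gives a neighbour of positive capacity. *)
have [b /andP[ab nb]] : exists b, e a b && (0 < nu b).
  apply/existsP; apply: contraT => /existsPn z.
  have := H [set a]; rewrite big_set1 leNgt big1 ?ma0 // => v.
  rewrite inE => /exists_inP[u]; rewrite inE => /eqP-> av.
  by have := z v; rewrite av /= -leNgt => v0; apply/eqP; rewrite eq_le nu0 v0.
pose mu' (t : R) u := mu u - (if u == a then t else 0).
pose nu' (t : R) v := nu v - (if v == b then t else 0).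
have pushK t pi : 0 <= t -> subcoupling (mu' t) (nu' t) pi ->
    exists pi, subcoupling mu nu pi.
  move=> t0 c; have := subcouplingD c (subcoupling_edge t0 ab).
  by move=> c'; eexists; apply: subcoupling_eq c' => u; rewrite /= subrK.
have m'0 t : t <= mu a -> forall u, 0 <= mu' t u.
  by move=> tm u; rewrite /mu'; case: eqP => [->|_]; rewrite ?subr0 ?subr_ge0.
have n'0 t : t <= nu b -> forall u, 0 <= nu' t u.
  by move=> tm u; rewrite /nu'; case: eqP => [->|_]; rewrite ?subr0 ?subr_ge0.
have m'z t u : mu u = 0 -> mu' t u = 0.
  rewrite /mu' => mu_u; case: eqP => [ua|_]; last by rewrite mu_u subrr.
  by rewrite -ua mu_u eqxx in ma.
have n'z t u : nu u = 0 -> nu' t u = 0.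
  rewrite /nu' => nu_u; case: eqP => [ub|_]; last by rewrite nu_u subrr.
  by rewrite -ub nu_u ltxx in nb.
(* Pushing along the edge from [a] to [b] hurts only the sets whose image loses mass at [b] while
   they lose none at [a]; [slack] is what such a set can afford. *)
pose bad S := (a \notin S) && (b \in rel_image e S).
pose slack S := \sum_(v in rel_image e S) nu v - \sum_(u in S) mu u.
have hall_push t : 0 <= t -> (forall S, bad S -> t <= slack S) ->
    hall (mu' t) (nu' t).
  move=> t0 tS A; rewrite !sumrB !sum_pred1.
  have [aA|aA] := boolP (a \in A).
    suff -> : b \in rel_image e A by rewrite lerD2r H.
    by rewrite inE; apply/exists_inP; exists a.
  case: ifP => bA; last by rewrite lerD2r H.
  by have := tS A; rewrite /bad aA bA => /(_ isT); rewrite /slack subr0; lra.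
pose t0 := Num.min (mu a) (nu b).
have t0_gt0 : 0 < t0 by rewrite lt_min ma0 nb.
(* If no bad set objects, the full push empties [a] or [b] and a support shrinks. *)
have [/forallP ok|] := boolP [forall S, bad S ==> (t0 <= slack S)].
  have h : hall (mu' t0) (nu' t0).
    by apply: hall_push => [|S]; [exact: ltW | apply/implyP].
  have [|||pi] := IH _ _ _ _ _ h.
  - apply: leq_trans len; rewrite /t0; case: leP => _.
      rewrite -addSn leq_add ?(nsupp_le (n'z _)) //.
      by apply: nsupp_lt (m'z _); [exact: ma | rewrite /mu' eqxx subrr].
    rewrite -addnS leq_add ?(nsupp_le (m'z _)) //.
    by apply: nsupp_lt (n'z _); [exact: (lt0r_neq0 nb) |
      rewrite /nu' eqxx subrr].
  - by apply: m'0; rewrite /t0 ge_min lexx.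
  - by apply: n'0; rewrite /t0 ge_min lexx orbT.
  by exact: pushK (ltW t0_gt0).
move=> /forallPn[S0]; rewrite negb_imply => /andP[bS0 ltS0].
(* Pushing exactly the least slack preserves Hall's condition and makes the minimising [S] tight. *)
case: (@Order.TotalTheory.arg_minP _ _ _ S0 bad slack bS0) => S bS minS.
have sS0 : slack S < t0 by apply: le_lt_trans (minS _ bS0) _; rewrite ltNge.
have sS : 0 <= slack S by rewrite subr_ge0.
move: sS0; rewrite lt_min => /andP[sma snb].
have h := hall_push _ sS minS.
have [aS bNS] := andP bS.
have tight : \sum_(u in S) mu' (slack S) u =
             \sum_(v in rel_image e S) nu' (slack S) v.
  by rewrite !sumrB !sum_pred1 (negbTE aS) bNS /slack; lra.
have nu'0 := n'0 _ (ltW snb); have mu'0 := m'0 _ (ltW sma).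
have [h1 h2] := hall_split nu'0 h tight.
(* Both halves are smaller: [a] lies outside [S], so the first half loses [a]; [b] lies in the image
   of [S], so the second loses [b]. *)
have [|||pi1 c1] := IH _ _ _ _ _ h1.
- apply: leq_trans len; rewrite -addSn leq_add //.
    apply: (nsupp_lt ma); first by rewrite (negbTE aS).
    by move=> u; case: ifP => // _; apply: m'z.
  by apply: nsupp_le => u; case: ifP => // _; apply: n'z.
- by move=> u; case: ifP.
- by move=> u; case: ifP.
have [|||pi2 c2] := IH _ _ _ _ _ h2.
- apply: leq_trans len; rewrite -addnS leq_add //.
    by apply: nsupp_le => u; case: ifP => // _; apply: m'z.
  apply: (nsupp_lt (lt0r_neq0 nb)); first by rewrite inE bNS.
  by move=> u; case: ifP => // _; apply: n'z.
- by move=> u; case: ifP.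
- by move=> u; case: ifP.
apply: pushK sS _; apply: subcoupling_eq (subcouplingD c1 c2) => u.
  by rewrite inE; case: (u \in S); rewrite /= ?addr0 ?add0r.
by rewrite [u \in ~: _]inE; case: (u \in rel_image e S);
  rewrite /= ?addr0 ?add0r.
Qed.

End Hall.

(** * Kantorovich duality with integer potentials *)

Section Kantorovich.
Variables (R : realFieldType) (T : finType) (c : T -> T -> nat).
Implicit Types (f g : T -> int) (mu nu : T -> R) (pi : T -> T -> R).

Definition lipschitz f := forall u v, f u - f v <= (c u v)%:Z.

Definition transport mu nu pi :=
  [/\ forall u v, 0 <= pi u v, forall u, \sum_v pi u v = mu u &
      forall v, \sum_u pi u v = nu v].

Definition pairing f mu := \sum_u (f u)%:~R * mu u.

Definition cost pi := \sum_u \sum_v (c u v)%:R * pi u v.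

Lemma transport_pairing mu nu pi f : transport mu nu pi ->
  \sum_u \sum_v (f u - f v)%:~R * pi u v = pairing f (mu \- nu).
Proof.
case=> _ pr pc.
under eq_bigr => u _ do under eq_bigr => v _ do rewrite rmorphB mulrBl.
under eq_bigr => u _ do rewrite sumrB -mulr_sumr pr.
rewrite sumrB exchange_big /=.
under [X in _ - X]eq_bigr => u _ do rewrite -mulr_sumr pc.
by rewrite -sumrB; apply: eq_bigr => u _; rewrite mulrBr.
Qed.

Lemma pairing_le_cost mu nu pi f :
  lipschitz f -> transport mu nu pi -> pairing f (mu \- nu) <= cost pi.
Proof.
move=> lf tp; rewrite -(transport_pairing f tp); case: tp => p0 _ _.
apply: ler_sum => u _; apply: ler_sum => v _; apply: ler_wpM2r => //.
by rewrite [leRHS]pmulrn ler_int lf.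
Qed.

Hypotheses (c0 : forall u, c u u = 0%N)
  (ctri : forall u v w, (c u w <= c u v + c v w)%N).

(* Tightness [f u - f v = c u v] is transitive, so raising a maximal [f] by 1
   on the tight image [B] of [A] keeps it 1-Lipschitz; maximality then forces
   [mu A <= mu B <= nu B], which is Hall's condition. *)
Theorem kantorovich mu nu f :
  (forall u, 0 <= mu u) -> (forall u, 0 <= nu u) ->
  \sum_u mu u = \sum_u nu u -> lipschitz f ->
  (forall g, lipschitz g -> pairing g (mu \- nu) <= pairing f (mu \- nu)) ->
  exists2 pi, transport mu nu pi & cost pi = pairing f (mu \- nu).
Proof.
move=> mu0 nu0 mass lf maxf.
pose tight := [rel u v | f u - f v == (c u v)%:Z].
have tight_refl u : tight u u by rewrite /= c0 subrr.
have tight_trans u v w : tight u v -> tight v w -> tight u w.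
  by move=> /= /eqP uv /eqP vw; rewrite eq_le lf /=; have := ctri u v w; lia.
have hall_tight : hall tight mu nu.
  move=> A; set B := rel_image tight A.
  have AB : A \subset B.
    apply/fintype.subsetP => u uA; rewrite inE; apply/exists_inP.
    by exists u => //; exact: tight_refl.
  pose g u := f u + (u \in B)%:Z.
  have lg : lipschitz g.
    move=> u v; rewrite /g; have := lf u v.
    have [uB|uB] := boolP (u \in B);
      last by case: (v \in B); rewrite ?addr0 /=; lia.
    have [vB|vB] := boolP (v \in B); first by lia.
    rewrite le_eqVlt => /orP[uv|]; last by lia.
    suff : v \in B by rewrite (negbTE vB).
    move: uB; rewrite !inE => /exists_inP[t tA tu]; apply/exists_inP.
    by exists t => //; apply: tight_trans tu uv.
  apply: le_trans (ler_sum_subset mu0 AB) _.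
  rewrite -subr_le0 -sumrB; have := maxf g lg; rewrite -subr_le0.
  rewrite /pairing -sumrB; congr (_ <= 0); rewrite [RHS]big_mkcond /=.
  apply: eq_bigr => u _.
  rewrite /g rmorphD mulrDl addrAC subrr add0r.
  by case: (u \in B); rewrite ?mul1r ?mul0r.
have [pi [p0 pe pr pc]] := weighted_hall mu0 nu0 hall_tight.
(* The column deficits are nonnegative and, the masses being equal, add up to 0. *)
have pc' v : \sum_u pi u v = nu v.
  apply/eqP; rewrite -subr_eq0 -oppr_eq0 opprB; apply/eqP.
  apply: (psumr_eq0P (P := predT) (F := fun v => nu v - \sum_u pi u v)) => //.
    by move=> ? _; rewrite subr_ge0.
  rewrite sumrB exchange_big /= -mass; apply/eqP; rewrite subr_eq0; apply/eqP.
  by apply: eq_bigr => u _; rewrite pr.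
have tp : transport mu nu pi by split.
exists pi => //; rewrite -(transport_pairing f tp).
apply: eq_bigr => u _; apply: eq_bigr => v _.
have [->|/pe /= /eqP ->] := eqVneq (pi u v) 0; first by rewrite !mulr0.
by rewrite -pmulrn.
Qed.

(** As the total weight is 0, [f] may be measured from a base point; the Lipschitz bound then caps
    the weighted sums, and integers bounded above have a largest one. *)
Lemma exists_max_potential (w : T -> int) (P : (T -> int) -> Prop) f0 :
  \sum_u w u = 0 -> P f0 -> (forall f, P f -> lipschitz f) ->
  exists2 f, P f & forall g, P g -> \sum_u g u * w u <= \sum_u f u * w u.
Proof.
move=> w0 Pf0 Plip.
pose k f := \sum_u f u * w u.
have [K kK] : exists K : int, forall f, lipschitz f -> k f <= K.
  have [y _|noT] := pickP (@predT T); last first.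
    by exists 0 => f _; rewrite /k big1 // => u; have := noT u.
  exists (\sum_u (c u y + c y u)%:Z * `|w u|) => f lf.
  have -> : k f = \sum_u (f u - f y) * w u.
    under [RHS]eq_bigr do rewrite mulrBl.
    by rewrite sumrB -mulr_sumr w0 mulr0 subr0.
  apply: ler_sum => u _; apply: le_trans (ler_norm _) _; rewrite normrM.
  by apply: ler_wpM2r => //; have := lf u y; have := lf y u; lia.
pose Q n := `[< exists2 f, P f & n = `|K - k f|%N >].
have exQ : exists n, Q n by exists `|K - k f0|%N; apply/asboolP; exists f0.
case: (ex_minnP exQ) => n /asboolP[f Pf nE] nmin; exists f => // g Pg.
have := nmin `|K - k g|%N; rewrite nE => /(_ _); rewrite -/(k g) -/(k f).
have := kK _ (Plip _ Pf); have := kK _ (Plip _ Pg).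
move=> ? ? h; have : (`|K - k f| <= `|K - k g|)%N.
  by apply: h; apply/asboolP; exists g.
lia.
Qed.

(** Half the sum is rounded down for [h.1] and up for [h.2]. The bracketing determines both from
    [f u + g u], so points with equal sums receive equal values. *)
Lemma lipschitz_half_sum f g : lipschitz f -> lipschitz g ->
  exists2 h : (T -> int) * (T -> int), lipschitz h.1 /\ lipschitz h.2 &
    forall u, h.1 u + h.2 u = f u + g u /\ h.1 u <= h.2 u <= h.1 u + 1.
Proof.
move=> lf lg.
exists ((fun u => ((f u + g u) %/ 2)%Z), (fun u => ((f u + g u + 1) %/ 2)%Z)).
  by split=> u v /=; have := lf u v; have := lg u v; lia.
by move=> u /=; split; lia.
Qed.

End Kantorovich.

(** * Lazy random walks on a finite metric space *)

Section RaisePotential.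
Variables (T : finType) (c : T -> T -> nat) (x y : T) (Sx Sy : {set T}).
Variables (a b : nat).
Hypotheses (c0 : forall u, c u u = 0%N)
  (ctri : forall u v w, (c u w <= c u v + c v w)%N).
Hypotheses (cxy : c x y = 1%N) (xSx : x \notin Sx) (ySx : y \in Sx)
  (ySy : y \notin Sy).
Hypotheses (cSx : forall u, u \in Sx -> (c u x <= 1)%N)
  (cSy : forall u, u != y -> u \notin Sy -> (2 <= c u y)%N).

(** When [a] and [b] are a common multiple [L] of the sphere sizes divided by those sizes, this is
    [L] times the difference of the uniform measures on [Sx] and [Sy], cleared of denominators. *)
Definition walk_weight u : int := (u \in Sx)%:Z * a%:Z - (u \in Sy)%:Z * b%:Z.

(* [g] is the least 1-Lipschitz function agreeing with [f] on [P]; off [P] only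
   [y] has positive weight. *)
Lemma raise_potential f : (a <= b)%N -> lipschitz c f -> f x = f y ->
  exists2 g, lipschitz c g /\ g x - g y = 1 &
    \sum_u f u * walk_weight u <= \sum_u g u * walk_weight u + a%:Z.
Proof.
move=> ab lf fxy.
pose P := x |: [set u in Sx | (u != y) && (u \notin Sy)].
have xP : x \in P by rewrite !inE eqxx.
pose m v p := f p - (c p v)%:Z.
pose p v := [arg max_(q > x in P) m v q]%O.
have [pP pmax] : (forall v, p v \in P) /\
    (forall v q, q \in P -> m v q <= m v (p v)).
  by split=> v; rewrite /p; case: arg_maxP => // q qP qmax; exact: qmax.
pose g v := m v (p v).
have lg : lipschitz c g.
  move=> u v; have := pmax v _ (pP u); rewrite /g /m.
  by have := ctri (p u) u v; lia.
have gf v : g v <= f v by have := lf (p v) v; rewrite /g /m; lia.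
have gP v : v \in P -> g v = f v.
  by move=> vP; have := pmax v v vP; have := gf v; rewrite /g /m c0; lia.
(* The point [x] contributes [f x - 1]. Any other point of [P] is within 1 of [x] and at least 2
   away from [y], so it contributes no more. *)
have gy : g y = f x - 1.
  have := pmax y x xP; rewrite -/(g y) /m cxy => gy_ge.
  suff : g y <= f x - 1 by lia.
  rewrite /g /m; have := pP y; rewrite !inE => /orP[/eqP->|].
    by rewrite cxy.
  move=> /and3P[pS py pSy]; have := cSx pS; have := cSy py pSy.
  by have := lf (p y) x; lia.
have gx := gP x xP.
exists g; first by split=> //; lia.
rewrite -lerBlDl -sumrB (bigD1 y) //=.
have -> : f y * walk_weight y - g y * walk_weight y = a%:Z.
  by rewrite /walk_weight ySx (negbTE ySy) gy -fxy; lia.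
(* Away from [y], [g] is below [f] only where the weight is not positive: outside [Sx], or in both
   spheres, where it is [a - b]. *)
rewrite gerDl; apply: sumr_le0 => u uy; rewrite -mulrBl.
have [uP|uP] := boolP (u \in P); first by rewrite gP // subrr mul0r.
apply: mulr_ge0_le0; first by rewrite subr_ge0.
move: uP; rewrite !inE negb_or negb_and uy /= negbK /walk_weight => /andP[_].
by case: (u \in Sx); case: (u \in Sy) => //=; lia.
Qed.

End RaisePotential.

(** The branches stand for potentials with [f x - f y] equal to 1, 0 and -1; [A], [B], [C] are their
    best values at idleness 0. *)
Definition max_affine (R : realFieldType) (A B C z : R) : R :=
  Num.max (z + (1 - z) * A) (Num.max ((1 - z) * B) (- z + (1 - z) * C)).

Section IdlenessFinite.
Variables (R : realFieldType).
Variables (T : finType) (c : T -> T -> nat) (x y : T) (Sx Sy : {set T}).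
Variables (a b L : nat).
Hypotheses (c0 : forall u, c u u = 0%N)
  (ctri : forall u v w, (c u w <= c u v + c v w)%N).
Hypotheses (cxy : c x y = 1%N) (cyx : c y x = 1%N)
  (xSx : x \notin Sx) (ySx : y \in Sx) (ySy : y \notin Sy) (xSy : x \in Sy).
Hypotheses (cSx : forall u, u \in Sx -> (c u x <= 1)%N)
  (cSx' : forall u, u != x -> u \notin Sx -> (2 <= c x u)%N)
  (cSy : forall u, u != y -> u \notin Sy -> (2 <= c u y)%N)
  (cSy' : forall u, u \in Sy -> (c y u <= 1)%N).
Hypotheses (L0 : (0 < L)%N) (aL : (a * #|Sx| = L)%N) (bL : (b * #|Sy| = L)%N).

Let w := walk_weight Sx Sy a b.

Lemma raise_potential_minn f : lipschitz c f -> f x = f y ->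
  exists2 g, lipschitz c g /\ g x - g y = 1 &
    \sum_u f u * w u <= \sum_u g u * w u + (minn a b)%:Z.
Proof.
move=> lf fxy; have [ab|ab] := leqP a b; first exact: raise_potential.
(* Negating the potential and reversing the distance exchanges [x] and [y], which reduces [b < a] to
   the case already treated. *)
pose c' u v := c v u.
have [||||||||||g [lg gyx] gw] :=
  @raise_potential T c' y x Sy Sx b a _ _ _ _ _ _ _ _ (fun u => - f u) (ltnW ab).
all: rewrite /c' //.
- by move=> u v t; rewrite addnC; apply: ctri.
- by move=> u v; have := lf v u; lia.
- by rewrite fxy.
exists (fun u => - g u); first split; try lia.
  by move=> u v; have := lg v u; rewrite /c'; lia.
have wN u : walk_weight Sy Sx b a u = - w u by rewrite /w /walk_weight opprB.
move: gw; under eq_bigr do rewrite wN mulrNN.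
by under [X in _ <= X + _ -> _]eq_bigr do rewrite wN mulrN -mulNr.
Qed.

Lemma sum_walk_weight : \sum_u w u = 0.
Proof.
rewrite sumrB -!mulr_suml -!rmorph_sum /=.
rewrite -!big_mkcond /= !sum1_card.
by rewrite -!PoszM mulnC aL mulnC bL subrr.
Qed.

Definition lazy_walk (S : {set T}) (z : T) (alpha : R) u : R :=
  alpha * (u == z)%:R + (1 - alpha) / #|S|%:R * (u \in S)%:R.

Definition max_three (k1 k0 km : int) : R -> R :=
  max_affine (k1%:~R / L%:R) (k0%:~R / L%:R) (km%:~R / L%:R).

Lemma card_Sx_gt0 : (0 < #|Sx|)%N.
Proof. by apply/card_gt0P; exists y. Qed.

Lemma card_Sy_gt0 : (0 < #|Sy|)%N.
Proof. by apply/card_gt0P; exists x. Qed.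

Lemma lazy_walk_ge0 (S : {set T}) z alpha u :
  0 <= alpha <= 1 -> 0 <= lazy_walk S z alpha u.
Proof.
move=> /andP[a0 a1]; rewrite /lazy_walk addr_ge0 ?mulr_ge0 ?invr_ge0 ?ler0n //.
by rewrite subr_ge0.
Qed.

Lemma sum_lazy_walk (S : {set T}) z alpha :
  (0 < #|S|)%N -> \sum_u lazy_walk S z alpha u = 1.
Proof.
move=> S0; rewrite big_split /= -!mulr_sumr -!natr_sum.
rewrite -(big_mkcond (mem S)) -(big_mkcond (pred1 z)) /= big_pred1_eq sum1_card.
by rewrite mulr1 mulfVK ?pnatr_eq0 -?lt0n //; lra.
Qed.

(** The potential enters only through two integers, [f x - f y] and the weighted sum. *)
Lemma pairing_lazy_walk (f : T -> int) alpha :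
  pairing f (lazy_walk Sx x alpha \- lazy_walk Sy y alpha) =
  alpha * (f x - f y)%:~R + (1 - alpha) * ((\sum_u f u * w u)%:~R / L%:R).
Proof.
have Sx0 := card_Sx_gt0; have Sy0 := card_Sy_gt0.
have inv_card (S : {set T}) q :
    (q * #|S| = L)%N -> (#|S|%:R^-1 : R) = q%:R / L%:R.
  move=> qL; rewrite -qL natrM invfM mulrA.
  have : (q * #|S| != 0)%N by rewrite qL -lt0n.
  by rewrite muln_eq0 negb_or => /andP[q0 _]; rewrite divff ?mul1r ?pnatr_eq0.
have single z : \sum_u (f u)%:~R * (u == z)%:R = (f z)%:~R :> R.
  rewrite (bigD1 z) //= eqxx mulr1 big1 ?addr0 // => u /negbTE ->.
  by rewrite mulr0.
rewrite intrB -(single x) -(single y) -sumrB mulr_sumr rmorph_sum /=.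
rewrite mulr_suml mulr_sumr -big_split /=; apply: eq_bigr => u _.
rewrite /lazy_walk (inv_card _ _ aL) (inv_card _ _ bL) /w /walk_weight.
rewrite rmorphM rmorphB !rmorphM /= -!pmulrn; ring.
Qed.

(** The three integers are the largest weighted sums over potentials with [f x - f y] equal to 1, 0
    and -1. They do not involve [alpha], so one triple serves every idleness. *)
Theorem lazy_transport_cost :
  exists k1 k0 km : int,
    [/\ k1 + km <= k0 + k0, k0 - k1 <= (minn a b)%:Z &
    forall alpha : R, 0 <= alpha <= 1 ->
      (exists2 pi, transport (lazy_walk Sx x alpha) (lazy_walk Sy y alpha) pi &
         cost c pi = max_three k1 k0 km alpha) /\
      forall pi, transport (lazy_walk Sx x alpha) (lazy_walk Sy y alpha) pi ->
         max_three k1 k0 km alpha <= cost c pi].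
Proof.
pose A (j : int) f := lipschitz c f /\ f x - f y = j.
have maxA j : (exists f, A j f) ->
    exists2 f, A j f & forall g, A j g -> \sum_u g u * w u <= \sum_u f u * w u.
  move=> [f0 Af0]; apply: (exists_max_potential (c := c) sum_walk_weight Af0).
  by move=> f [].
(* Each class is inhabited: the distance to [y] has difference 1, the zero potential 0, and minus
   the distance from [y] has difference -1. *)
have [|f1 A1 max1] := maxA 1.
  exists (fun u => (c u y)%:Z); split; last by rewrite cxy c0.
  by move=> u v; have := ctri u v y; lia.
have [|f0 A0 max0] := maxA 0.
  by exists (fun u => 0); split=> // u v; rewrite subrr.
have [|fm Am maxm] := maxA (-1).
  exists (fun u => - (c y u)%:Z); split; last by rewrite cyx c0.
  by move=> u v; have := ctri y u v; lia.
exists (\sum_u f1 u * w u), (\sum_u f0 u * w u), (\sum_u fm u * w u).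
split.
(* The differences 1 and -1 cancel in the sum of [f1] and [fm], so both rounded halves have
   difference 0 and compete with [f0]. *)
- have [[h1 h2] [lh1 lh2] /= hE] := lipschitz_half_sum A1.1 Am.1.
  have [hx ?] := hE x; have [hy ?] := hE y.
  have := A1.2; have := Am.2 => e1 e2.
  have Ah1 : A 0 h1 by split=> //; lia.
  have Ah2 : A 0 h2 by split=> //; lia.
  apply: le_trans (lerD (max0 _ Ah1) (max0 _ Ah2)).
  rewrite -!big_split /=; apply: ler_sum => u _.
  by rewrite -!mulrDl; have [-> _] := hE u.
- have [|g Ag gw] := raise_potential_minn A0.1; first by have := A0.2; lia.
  by have := max1 g Ag; lia.
move=> alpha a01; have /andP[al0 al1] := a01.
have al1' : 0 <= 1 - alpha by rewrite subr_ge0.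
have pairing_m f := pairing_lazy_walk f alpha.
set m := _ \- _ in pairing_m.
set M := max_three _ _ _ _.
have le_M g : lipschitz c g -> pairing g m <= M.
  move=> lg; rewrite pairing_m /M /max_three /max_affine !le_max.
  have mono k : \sum_u g u * w u <= k ->
      (1 - alpha) * ((\sum_u g u * w u)%:~R / L%:R) <=
      (1 - alpha) * (k%:~R / L%:R).
    by move=> gk; rewrite ler_wpM2l // ler_wpM2r ?invr_ge0 // ler_int.
  have : [\/ g x - g y = 1, g x - g y = 0 | g x - g y = -1].
    have := lg x y; have := lg y x; rewrite cxy cyx => ? ?.
    have : g x - g y = 1 \/ g x - g y = 0 \/ g x - g y = -1 by lia.
    by case=> [|[|]] ->; [apply: Or31|apply: Or32|apply: Or33].
  case=> gj; rewrite gj.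
  - by rewrite mulr1 lerD2l mono // max1.
  - by rewrite mulr0 add0r mono ?orbT // max0.
  - by rewrite mulrN1 lerD2l mono ?orbT // maxm.
(* The potential of the largest branch is optimal for this [alpha]. *)
have [f lf fE] : exists2 f, lipschitz c f & pairing f m = M.
  have e1 := pairing_m f1; rewrite A1.2 mulr1 in e1.
  have e0 := pairing_m f0; rewrite A0.2 mulr0 add0r in e0.
  have em := pairing_m fm; rewrite Am.2 mulrN1 in em.
  rewrite /M /max_three /max_affine -e1 -e0 -em.
  case: leP => _; last by exists f1 => //; exact: A1.1.
  by case: leP => _; [exists fm | exists f0] => //; [exact: Am.1 | exact: A0.1].
split.
  rewrite -fE; apply: kantorovich => //.
  - by move=> u; apply: lazy_walk_ge0.
  - by move=> u; apply: lazy_walk_ge0.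
  - by rewrite !sum_lazy_walk ?card_Sx_gt0 ?card_Sy_gt0.
  - by move=> g /le_M; rewrite -fE.
by move=> pi; rewrite -fE; apply: pairing_le_cost.
Qed.

End IdlenessFinite.

Local Open Scope classical_set_scope.
Local Open Scope ring_scope.

(** * Maxima of three affine functions *)

Section Piecewise.
Variable R : realType.
Implicit Types (f g : R -> R) (s t : R).

Lemma affine_on_sub (I J : set R) f :
  I `<=` J -> affine_on J f -> affine_on I f.
Proof. by move=> IJ [p [q pq]]; exists p, q => z /IJ; exact: pq. Qed.

Lemma affine_on_degenerate s t f : t <= s -> affine_on `[s, t] f.
Proof.
move=> ts; exists 0, (f s) => z /=; rewrite in_itv /= => /andP[sz zt].
rewrite mul0r add0r; congr f; apply/eqP; rewrite eq_le sz.
by rewrite (le_trans zt ts).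
Qed.

Lemma piecewise_linear01_le (k l : nat) f : (k <= l)%N ->
  piecewise_linear01 k f -> piecewise_linear01 l f.
Proof.
by move=> kl [m [c [mk c0 c1 h]]]; exists m, c; split=> //; exact: leq_trans kl.
Qed.

(** Pieces must have positive length, so a break at 0 is dropped and a single piece remains. *)
Lemma piecewise_linear01_2 t f : 0 <= t < 1 ->
  affine_on `[0, t] f -> affine_on `[t, 1] f -> piecewise_linear01 2 f.
Proof.
case/andP; rewrite le_eqVlt => /predU1P[<- _ _ f01|t0 t1 f0 f1].
  by exists 1%N, (fun i => i%:R); split=> // -[|//] _; rewrite ltr01.
exists 2%N, (fun i => match i with 0%N => 0 | 1%N => t | _ => 1 end).
by split=> // -[|[|//]].
Qed.

Lemma piecewise_linear01_3 s t f : 0 <= s -> s <= t -> t < 1 ->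
  affine_on `[0, s] f -> affine_on `[s, t] f -> affine_on `[t, 1] f ->
  piecewise_linear01 3 f.
Proof.
rewrite le_eqVlt => /predU1P[<- t0 t1 _ f0 f1|s0].
  apply: (@piecewise_linear01_le 2) => //.
  by apply: (@piecewise_linear01_2 t); rewrite ?t0.
rewrite le_eqVlt => /predU1P[<- s1 f0 _ f1|st t1 f0 f1 f2].
  apply: (@piecewise_linear01_le 2) => //.
  by apply: (@piecewise_linear01_2 s); rewrite ?(ltW s0).
exists 3%N, (fun i => match i with 0%N => 0 | 1%N => s | 2%N => t | _ => 1 end).
by split=> // -[|[|[|//]]].
Qed.

End Piecewise.

Section MaxThree.
Variables (R : realType) (A B C : R).
Hypothesis ABC : A + C <= B + B.

Local Notation M := (max_affine A B C).

(* The [z] solving [z = (1 - z) s]; negative [s] gives [0]. *)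
Definition breakpoint (s : R) : R := Num.max 0 s / (1 + Num.max 0 s).

Lemma breakpoint_ge0 s : 0 <= breakpoint s.
Proof.
by rewrite /breakpoint divr_ge0 ?addr_ge0 // le_max lexx.
Qed.

Lemma le_breakpoint s z : (z <= breakpoint s) = (z <= (1 - z) * Num.max 0 s).
Proof.
have h : 0 <= Num.max 0 s by rewrite le_max lexx.
rewrite /breakpoint ler_pdivlMr; last by lra.
by rewrite mulrDr mulr1 mulrBl mul1r lerBrDr.
Qed.

Lemma breakpoint_le s z : (breakpoint s <= z) = ((1 - z) * Num.max 0 s <= z).
Proof.
have h : 0 <= Num.max 0 s by rewrite le_max lexx.
rewrite /breakpoint ler_pdivrMr; last by lra.
by rewrite mulrDr mulr1 mulrBl mul1r lerBlDr.
Qed.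

Lemma breakpoint_lt1 s : breakpoint s < 1.
Proof.
have h : 0 <= Num.max 0 s by rewrite le_max lexx.
by rewrite /breakpoint ltr_pdivrMr; lra.
Qed.

Lemma breakpoint_mono s t : s <= t -> breakpoint s <= breakpoint t.
Proof.
move=> st; rewrite breakpoint_le; set z := breakpoint t.
have : breakpoint t <= z by [].
rewrite breakpoint_le; apply: le_trans.
rewrite ler_wpM2l ?subr_ge0 ?(ltW (breakpoint_lt1 _)) //.
by rewrite ge_max le_max lexx /= le_max st orbT.
Qed.

(** Below this break the third branch beats the second; by [ABC] the first branch is then below the
    second. *)
Lemma affine_on_low : affine_on `[0, breakpoint (C - B)] M.
Proof.
have [h|h] := leP (C - B) 0.
  by apply: affine_on_degenerate; rewrite breakpoint_le (max_idPl h) mulr0.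
exists (- 1 - C), C => z /=; rewrite in_itv /= => /andP[z0].
have := breakpoint_lt1 (C - B) => b1 /[dup] zb.
rewrite le_breakpoint (max_idPr (ltW h)) => zC.
have z1 : 0 <= 1 - z by lra.
have : (1 - z) * (A + C) <= (1 - z) * (B + B) by exact: ler_wpM2l.
move=> h2; have -> : (-1 - C) * z + C = - z + (1 - z) * C by ring.
rewrite /max_affine (max_idPr (_ : (1 - z) * B <= _)); last by lra.
by apply/max_idPr; lra.
Qed.

Lemma affine_on_mid : affine_on `[breakpoint (C - B), breakpoint (B - A)] M.
Proof.
have [h|h] := leP (B - A) 0.
  apply: affine_on_degenerate; apply: le_trans (breakpoint_ge0 _).
  by rewrite breakpoint_le (max_idPl h) mulr0.
exists (- B), B => z /=; rewrite in_itv /= le_breakpoint breakpoint_le.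
rewrite (max_idPr (ltW h)) => /andP[zC zA].
have z1 : 0 <= 1 - z.
  have := breakpoint_lt1 (B - A); move: zA.
  by rewrite -[B - A in leRHS](max_idPr (ltW h)) -le_breakpoint; lra.
have zC' : (1 - z) * (C - B) <= z.
  by apply: le_trans zC; rewrite ler_wpM2l // le_max lexx orbT.
have -> : - B * z + B = (1 - z) * B by ring.
rewrite /max_affine (max_idPl (_ : _ <= (1 - z) * B)); last by lra.
by apply/max_idPr; lra.
Qed.

(** Past this break the first branch beats the second, and [ABC] puts the third below the second. *)
Lemma affine_on_high : affine_on `[breakpoint (B - A), 1] M.
Proof.
exists (1 - A), A => z /=; rewrite in_itv /= breakpoint_le => /andP[zA z1].
have z1' : 0 <= 1 - z by lra.
have z0 : 0 <= z by apply: le_trans zA; rewrite mulr_ge0 // le_max lexx.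
have zA' : (1 - z) * (B - A) <= z.
  by apply: le_trans zA; rewrite ler_wpM2l // le_max lexx orbT.
have h : (1 - z) * (A + C) <= (1 - z) * (B + B) by exact: ler_wpM2l.
have -> : (1 - A) * z + A = z + (1 - z) * A by ring.
by apply/max_idPl; rewrite ge_max; apply/andP; split; lra.
Qed.

(** Each branch is affine, so at a convex combination it is bounded by the same combination of the
    maxima. *)
Lemma concave_one_sub_max (f : R -> R) :
  (forall z, 0 <= z <= 1 -> f z = 1 - M z) -> concave_function `[0, 1] f.
Proof.
move=> fE t u v; rewrite !inE /= !in_itv /= => u01 v01.
have t0 : 0 <= t%:num by [].
have t1 : 0 <= 1 - t%:num by rewrite subr_ge0.
rewrite !convRE /= /unstable.onem.
have w01 : 0 <= t%:num * u + (1 - t%:num) * v <= 1.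
  by move/andP: u01 => [? ?]; move/andP: v01 => [? ?]; nra.
rewrite fE // fE // fE //.
have le_M z : [/\ z + (1 - z) * A <= M z, (1 - z) * B <= M z &
    - z + (1 - z) * C <= M z].
  by rewrite /max_affine; split; rewrite !le_max lexx ?orbT.
set w := _ + _ * v in w01 *.
suff : M w <= t%:num * M u + (1 - t%:num) * M v by lra.
rewrite /max_affine !ge_max -/(M u) -/(M v) /w.
have [a1 a2 a3] := le_M u; have [b1 b2 b3] := le_M v.
have := ler_wpM2l t0 a1; have := ler_wpM2l t0 a2; have := ler_wpM2l t0 a3.
have := ler_wpM2l t1 b1; have := ler_wpM2l t1 b2; have := ler_wpM2l t1 b3.
by move=> *; apply/and3P; split; lra.
Qed.

End MaxThree.

(** * Location of the breaks for integer data *)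

Section IntegralMaxThree.
Variables (R : realType) (k1 k0 km : int) (L D m : nat).
Hypotheses (L0 : (0 < L)%N) (mDL : (m * D = L)%N)
  (k_mid : k1 + km <= k0 + k0) (k_gap : k0 - k1 <= m%:Z).

Local Notation A := (k1%:~R / L%:R : R).
Local Notation B := (k0%:~R / L%:R : R).
Local Notation C := (km%:~R / L%:R : R).

Let Lpos : (0 : R) < L%:R. Proof. by rewrite ltr0n. Qed.

Lemma mid_slope_ge : A + C <= B + B.
Proof. by rewrite -!mulrDl ler_pM2r ?invr_gt0 // -!intrD ler_int. Qed.

Lemma breakpoint_le0 (s : R) : s <= 0 -> breakpoint s = 0.
Proof. by move=> s0; rewrite /breakpoint (max_idPl s0) mul0r. Qed.

Lemma inv_le_breakpoint (s z : R) : 0 < z -> z^-1 <= s ->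
  (z + 1)^-1 <= breakpoint s.
Proof.
move=> z0 zs; have z1 : 0 < z + 1 by lra.
rewrite le_breakpoint.
have -> : 1 - (z + 1)^-1 = (z + 1)^-1 * z by field; lra.
rewrite -mulrA ler_peMr ?invr_ge0 ?(ltW z1) //.
by rewrite -(mulfV (lt0r_neq0 z0)) ler_wpM2l ?(ltW z0) // le_max zs orbT.
Qed.

Lemma breakpoint_le_inv (s z : R) : 0 < z -> s <= z^-1 ->
  breakpoint s <= (z + 1)^-1.
Proof.
move=> z0 zs; have z1 : 0 < z + 1 by lra.
rewrite breakpoint_le.
have -> : 1 - (z + 1)^-1 = (z + 1)^-1 * z by field; lra.
rewrite -mulrA ler_piMr ?invr_ge0 ?(ltW z1) //.
rewrite -(mulfV (lt0r_neq0 z0)) ler_wpM2l ?(ltW z0) // ge_max zs.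
by rewrite invr_ge0 ltW.
Qed.

(** The argument is an integer multiple of [1 / L]: at most 0 or at least [1 / L]. *)
Lemma breakpoint_int (k l : int) :
  breakpoint (k%:~R / L%:R - l%:~R / L%:R : R) = 0 \/
  (L%:R + 1)^-1 <= breakpoint (k%:~R / L%:R - l%:~R / L%:R : R).
Proof.
rewrite -mulrBl -intrB; have [kl|kl] := leP (k - l) 0; [left|right].
  apply: breakpoint_le0.
  by rewrite pmulr_lle0 ?invr_gt0 // -[0]/(0%:~R) ler_int.
apply: inv_le_breakpoint => //.
by rewrite ler_peMl ?invr_ge0 ?(ltW Lpos) // (ler_int _ 1).
Qed.

Lemma itv_subset (a b c d : R) : c <= a -> b <= d -> `[a, b] `<=` `[c, d].
Proof.
move=> ca bd z /=; rewrite !in_itv /= => /andP[az zb].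
by rewrite (le_trans ca az) (le_trans zb bd).
Qed.

(** Neither break lies strictly between 0 and [(L%:R + 1)^-1], so the interval falls inside one of
    the three pieces. *)
Lemma max_three_low : affine_on `[0, (L%:R + 1)^-1] (max_affine A B C).
Proof.
have L1 : ((L%:R + 1)^-1 : R) <= 1 by rewrite invf_le1; have := Lpos; lra.
have [CB0|CB] := breakpoint_int km k0; last first.
  by apply: affine_on_sub (affine_on_low mid_slope_ge); apply: itv_subset.
have [BA0|BA] := breakpoint_int k0 k1; last first.
  apply: affine_on_sub (affine_on_mid A B C).
  by apply: itv_subset; rewrite ?CB0.
apply: affine_on_sub (affine_on_high mid_slope_ge).
by apply: itv_subset; rewrite ?BA0.
Qed.

(** The second break has argument at most [m / L], which is [1 / D]. *)
Lemma max_three_high : affine_on `[(D%:R + 1)^-1, 1] (max_affine A B C).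
Proof.
have D0 : (0 < D)%N by move: L0; rewrite -mDL muln_gt0 => /andP[].
apply: affine_on_sub (affine_on_high mid_slope_ge); apply: itv_subset => //.
apply: breakpoint_le_inv; first by rewrite ltr0n.
rewrite -mulrBl -intrB ler_pdivrMr // -mDL natrM mulrCA.
rewrite mulVf ?mulr1 ?pnatr_eq0 -?lt0n //.
by rewrite [leRHS]pmulrn ler_int.
Qed.

Lemma one_sub_affine (I : set R) (f g : R -> R) :
  (forall z, I z -> f z = 1 - g z) -> affine_on I g -> affine_on I f.
Proof.
move=> fg [p [q gE]]; exists (- p), (1 - q) => z Iz.
by rewrite fg // gE //; ring.
Qed.

Lemma idleness_shape (f : R -> R) :
  (forall z, 0 <= z <= 1 -> f z = 1 - max_affine A B C z) ->
  [/\ concave_function `[0, 1] f, piecewise_linear01 3 f,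
    affine_on `[0, (L%:R + 1)^-1] f, affine_on `[(D%:R + 1)^-1, 1] f &
    L = D -> piecewise_linear01 2 f].
Proof.
move=> fE; have ABC := mid_slope_ge.
have D0 : (0 : R) < D%:R by move: L0; rewrite -mDL muln_gt0 ltr0n => /andP[].
have sub (a b : R) : 0 <= a -> b <= 1 -> affine_on `[a, b] (max_affine A B C) ->
    affine_on `[a, b] f.
  move=> a0 b1; apply: one_sub_affine => z /=.
  rewrite in_itv /= => /andP[az zb].
  by apply: fE; rewrite (le_trans a0 az) (le_trans zb b1).
have inv01 (z : R) : 0 < z -> 0 <= (z + 1)^-1 < 1.
  by move=> z0; rewrite invr_ge0 invf_lt1; lra.
have low : affine_on `[0, (L%:R + 1)^-1] f.
  by apply: sub max_three_low => //; have := inv01 _ Lpos; lra.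
have high : affine_on `[(D%:R + 1)^-1, 1] f.
  by apply: sub max_three_high => //; have := inv01 _ D0; lra.
split=> //; first exact: concave_one_sub_max fE.
  apply: (@piecewise_linear01_3 _ (breakpoint (C - B)) (breakpoint (B - A))).
  - exact: breakpoint_ge0.
  - by apply: breakpoint_mono; move: ABC; lra.
  - exact: breakpoint_lt1.
  - by apply: sub (affine_on_low ABC) => //; exact: ltW (breakpoint_lt1 _).
  - apply: sub (affine_on_mid A B C); rewrite ?breakpoint_ge0 //.
    exact: ltW (breakpoint_lt1 _).
  - by apply: sub (affine_on_high ABC); rewrite ?breakpoint_ge0.
(* For [L = D] the two intervals share an end and cover [[0, 1]]. *)
move=> LD; apply: (@piecewise_linear01_2 _ (L%:R + 1)^-1) => //.
  exact: inv01.
by rewrite LD.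
Qed.

End IntegralMaxThree.

(** * Distances and spheres in a hypergraph *)

Section HypergraphDistance.
Variables (V : choiceType) (E : hypergraph V).
Implicit Types (u v w : V) (n : nat).

(** The index only bounds the length. The first alternative matches the separate value 0 of [hdist]
    at equal vertices, since every hyperpath has positive length. *)
Definition hwalk n u v :=
  u = v \/ exists2 p, hyperpath E u v p & (size p <= n)%N.

(** Without a walk this is the default 0, hence the walk hypotheses in the lemmas that follow. *)
Definition hdistn u v : nat :=
  xget 0%N [set n | hwalk n u v /\ forall k, hwalk k u v -> (n <= k)%N].

Lemma hdistnP n u v :
  hwalk n u v -> hwalk (hdistn u v) u v /\ (hdistn u v <= n)%N.
Proof.
move=> walk_n; have ex : exists k, `[< hwalk k u v >].
  by exists n; apply/asboolP.
case: (ex_minnP ex) => k /asboolP walk_k kmin.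
have : [set n | hwalk n u v /\ forall k, hwalk k u v -> (n <= k)%N] k.
  by split=> // l /asboolP; exact: kmin.
move=> /(@xgetI _ 0%N) []; rewrite -/(hdistn u v) => ? dmin; split=> //.
exact: dmin.
Qed.

Lemma hdistn_refl u : hdistn u u = 0%N.
Proof.
by apply/eqP; rewrite -leqn0; have [|//] := @hdistnP 0 u u _; left.
Qed.

Lemma hdistE (R : realType) n u v : hwalk n u v ->
  hdist R E u v = (hdistn u v)%:R%:E.
Proof.
move=> walk_n; rewrite /hdist; case: eqVneq => [->|uv].
  by rewrite hdistn_refl.
have [[/eqP|[p pp sp] _]] := hdistnP walk_n; first by rewrite (negbTE uv).
apply/eqP; rewrite eq_le; apply/andP; split.
  apply: ereal_inf_lbound; exists p => //=; congr (_%:R%:E).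
  apply/eqP; rewrite eqn_leq sp.
  by have [|_ ->] := @hdistnP (size p) u v; first by right; exists p.
apply: le_ereal_inf_tmp => _ [q qp <-]; rewrite lee_fin ler_nat.
by have [|_ ->] := @hdistnP (size q) u v; first by right; exists q.
Qed.

(** The hyperedges at the junction share [v], but the concatenation may repeat hyperedges;
    [shortenP] removes the repetitions. *)
Lemma hyperpath_cat u v w p q : hyperpath E u v p -> hyperpath E v w q ->
  exists2 s, hyperpath E u w s & (size s <= size p + size q)%N.
Proof.
case: p => [|e p]; first by case=> _ _; rewrite in_fset0.
case: q => [|f q]; first by move=> _ [_ _]; rewrite in_fset0.
move=> [_ Ep /= ue ve ep] [_ Eq /= vf wf fq].
have pathP :
    path (fun e f : {fset V} => (e `&` f)%fset != fset0) e (p ++ f :: q).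
  rewrite cat_path ep /= fq andbT; apply/fset0Pn; exists v.
  by rewrite in_fsetI ve vf.
have : w \in last e (p ++ f :: q) by rewrite last_cat.
case/shortenP: pathP => s sP sU sE sL; exists (e :: s).
  split=> // g; rewrite inE => /predU1P[->|/sE].
    by apply: Ep; rewrite inE eqxx.
  rewrite mem_cat => /orP[gp|gq]; last exact: Eq.
  by apply: Ep; rewrite inE gp orbT.
move: sU => /= /andP[_ sU].
by have := uniq_leq_size sU sE; rewrite size_cat /= addSn ltnS.
Qed.

Lemma hwalk_trans m n u v w : hwalk m u v -> hwalk n v w -> hwalk (m + n) u w.
Proof.
case=> [<- [->|[q qP qn]]|[p pP pm] [<-|[q qP qn]]]; first by left.
- by right; exists q => //; exact: leq_trans (leq_addl _ _).
- by right; exists p => //; exact: leq_trans (leq_addr _ _).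
have [s sP ss] := hyperpath_cat pP qP.
by right; exists s => //; rewrite (leq_trans ss) ?leq_add.
Qed.

Lemma hdistn_triangle m n u v w : hwalk m u v -> hwalk n v w ->
  (hdistn u w <= hdistn u v + hdistn v w)%N.
Proof.
move=> /hdistnP[uv _] /hdistnP[vw _].
by have [] := hdistnP (hwalk_trans uv vw).
Qed.

Lemma hwalk_edge e u v : E e -> u \in e -> v \in e -> hwalk 1 u v.
Proof.
move=> Ee ue ve; right; exists [:: e] => //; split=> // g.
by rewrite inE => /eqP ->.
Qed.

Lemma hwalk1 n u v : (n <= 1)%N -> hwalk n u v -> u <> v ->
  exists e, [/\ E e, u \in e & v \in e].
Proof.
move=> n1 [uv /(_ uv)//|[p [_ pE up vp _] /leq_trans/(_ n1) p1]] _.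
case: p pE up vp p1 => [|e [|f p]] // pE /= up vp _.
by exists e; split=> //; apply: pE; rewrite inE.
Qed.

Lemma hadjacent_sym u v : hadjacent E u v -> hadjacent E v u.
Proof. by case=> uv [e [? ? ?]]; split; [rewrite eq_sym | exists e]. Qed.

Lemma hadjacent_walk u v : hadjacent E u v -> hwalk 1 u v.
Proof. by case=> _ [e [Ee ue ve]]; exact: hwalk_edge Ee ue ve. Qed.

Lemma hadjacent_hdistn u v : hadjacent E u v -> hdistn u v = 1%N.
Proof.
move=> uv; have [walk d1] := hdistnP (hadjacent_walk uv).
apply/eqP; rewrite eqn_leq d1 lt0n; apply/eqP => d0.
(* Length 0 would mean the empty sequence, whose head [fset0] contains no vertex. *)
move: walk; rewrite d0 => -[|[[|//] [_ _]]]; last by rewrite in_fset0.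
by apply/eqP; case: uv.
Qed.

Lemma hdistn_ge2 n u v : hwalk n u v -> u != v -> ~ hadjacent E u v ->
  (2 <= hdistn u v)%N.
Proof.
move=> walk uv nadj; rewrite ltnNge; apply/negP => d1; apply: nadj; split=> //.
by apply: (hwalk1 d1); [have [] := hdistnP walk | exact/eqP].
Qed.

Hypotheses (lfE : locally_finite E) (lE : linear_hypergraph E).

Definition star u : {fset {fset V}} := fset_set [set e | E e /\ u \in e].

Lemma in_star u e : e \in star u <-> E e /\ u \in e.
Proof.
by rewrite /star in_fset_set //; split=> [|h]; rewrite inE.
Qed.

Definition sphere u : {fset V} := (\bigcup_(e <- star u) (e `\ u))%fset.

Lemma in_sphere u z : z \in sphere u <-> hadjacent E z u.
Proof.
split=> [/bigfcupP[e /andP[/in_star[Ee ue] _]]|[zu [e [Ee ze ue]]]].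
  by rewrite !inE => /andP[zu ze]; split=> //; exists e.
apply/bigfcupP; exists e; last by rewrite !inE zu.
by rewrite andbT; apply/in_star.
Qed.

Lemma linear_edge_eq u z e f : z != u -> E e -> E f -> u \in e -> z \in e ->
  u \in f -> z \in f -> e = f.
Proof.
move=> zu Ee Ef ue ze uf zf; apply/eqP; apply: contraT => ef.
have := lE Ee Ef ef; rewrite leqNgt => /negP[].
have <- : #|` [fset z; u]%fset| = 2%N by rewrite cardfs2 zu.
apply: fsubset_leq_card; apply/fsubsetP => t; rewrite !inE => /orP[] /eqP ->.
  by rewrite ze zf.
by rewrite ue uf.
Qed.

(** By linearity, the hyperedges through [u] become disjoint once [u] is removed, and each keeps
    [r.-1] vertices. *)
Lemma card_sphere r u : uniform_hypergraph r E ->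
  #|` sphere u| = (hdegree E u * r.-1)%N.
Proof.
move=> uE; rewrite card_fset_sum1 partition_disjoint_bigfcup; last first.
  move=> e f /in_star[Ee ue] /in_star[Ef uf] ef.
  apply/fdisjointP => z; rewrite !inE => /andP[zu ze]; rewrite zu /=.
  by apply: contra ef => zf; apply/eqP; exact: linear_edge_eq Ee Ef ue ze uf zf.
rewrite big_seq (eq_bigr (fun=> r.-1)); last first.
  move=> e /in_star[Ee ue]; rewrite -card_fset_sum1.
  by rewrite -(uE e Ee) (cardfsD1 u e) ue.
by rewrite -big_seq big_const_seq count_predT iter_addn_0 mulnC.
Qed.

(** For adjacent vertices, linearity leaves a single hyperedge containing both, so the sum has one
    term [1 / (r - 1)]; together with the degree it gives one over the sphere size. *)
Lemma rw_measureE (R : realType) r (alpha : R) u z : uniform_hypergraph r E ->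
  rw_measure E alpha u z = alpha * (z == u)%:R +
    (1 - alpha) / #|` sphere u|%:R * (z \in sphere u)%:R.
Proof.
move=> uE; rewrite /rw_measure; case: eqVneq => [->|zu].
  have -> : (u \in sphere u) = false.
    by apply/negP => /in_sphere[]; rewrite eqxx.
  by rewrite mulr1 mulr0 addr0.
rewrite mulr0 add0r; case: asboolP => [[_ [e [Ee ze ue]]]|nadj]; last first.
  by case: (boolP (z \in _)) => [/in_sphere//|]; rewrite mulr0.
have -> : z \in sphere u by apply/in_sphere; split=> //; exists e.
rewrite mulr1 (card_sphere u uE) natrM invfM mulrA; congr (_ * _).
have -> : [set f | E f /\ ([fset u; z] `<=` f)%fset] = [set e].
  apply/seteqP; split=> [f /= [Ef /fsubsetP sf]|f ->]; last first.
    by split=> //; apply/fsubsetP => t; rewrite !inE => /orP[] /eqP ->.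
  apply: linear_edge_eq zu Ef Ee _ _ ue ze; apply: sf; rewrite !inE eqxx //.
  by rewrite orbT.
rewrite fsbig_set1 (uE e Ee); congr (_^-1).
have : (0 < r)%N by rewrite -(uE e Ee) (cardfsD1 u) ue.
by case: r {uE} => // r _; rewrite -natr1 addrK.
Qed.

End HypergraphDistance.

(** * Couplings of finitely supported measures *)

Section FiniteSupport.
Variables (R : realType) (V : choiceType) (U : {fset V}).

Lemma esum_fsupport (g : V -> \bar R) : (forall z, 0 <= g z)%E ->
  (forall z, z \notin U -> g z = 0)%E ->
  (\esum_(z in [set: V]) g z = \sum_(z : U) g (val z))%E.
Proof.
move=> g0 gU.
transitivity (\esum_(z in [set` U]) g z)%E.
  rewrite [RHS]esum_mkcond; apply: eq_esum => z _.
  case: ifPn => // /negP zU; apply: gU; apply/negP => h.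
  by apply: zU; rewrite inE.
rewrite esum_fset //.
by rewrite fsbig_finite ?set_fsetK ?big_seq_fsetE.
Qed.

Lemma le_esum_term (g : V -> \bar R) z : (g z <= \esum_(w in [set: V]) g w)%E.
Proof.
apply: esum_ge; exists [set z]; last by rewrite fsbig_set1.
by split=> //; exact: finite_set1.
Qed.

Variables (E : hypergraph V) (mu nu : V -> R).
Let c (u v : U) := hdistn E (val u) (val v).
Hypotheses (walkU : forall u v : U, exists n, hwalk E n (val u) (val v))
  (muU : forall z, z \notin U -> mu z = 0)
  (nuU : forall z, z \notin U -> nu z = 0)
  (mu1 : forall z, mu z <= 1).

Let restr (pi : V -> V -> R) (u v : U) := pi (val u) (val v).

(** A nonnegative entry is at most its row sum and its column sum, one of which vanishes here. *)
Lemma coupling_eq0 pi u v : coupling mu nu pi -> ~~ ((u \in U) && (v \in U)) ->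
  pi u v = 0.
Proof.
move=> [p01 pr pc]; rewrite negb_and; have /andP[p0 _] := p01 u v.
have le0 : pi u v <= 0 -> pi u v = 0.
  by move=> p_le0; apply/eqP; rewrite eq_le p_le0 p0.
case/orP=> [uU|vU]; apply: le0; rewrite -lee_fin.
  by rewrite -(muU uU) -pr; exact: (le_esum_term (fun w => (pi u w)%:E)).
by rewrite -(nuU vU) -pc; exact: (le_esum_term (fun w => (pi w v)%:E)).
Qed.

Lemma coupling_transport pi : coupling mu nu pi ->
  transport (mu \o val) (nu \o val) (restr pi).
Proof.
move=> cpi; have [p01 pr pc] := cpi;
have p0 u v : 0 <= pi u v by have /andP[] := p01 u v.
split=> [u v|u|v]; first exact: p0.
  apply: EFin_inj; rewrite -sumEFin -pr esum_fsupport // => z.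
    by rewrite lee_fin.
  by move=> zU; rewrite (coupling_eq0 cpi) // negb_and zU orbT.
apply: EFin_inj; rewrite -sumEFin -pc esum_fsupport // => z.
  by rewrite lee_fin.
by move=> zU; rewrite (coupling_eq0 cpi) // negb_and zU.
Qed.

Definition extend (pi : U -> U -> R) (u v : V) : R :=
  match insub u, insub v with Some u', Some v' => pi u' v' | _, _ => 0 end.

Lemma extendE pi u v : extend pi (val u) (val v) = pi u v.
Proof. by rewrite /extend !valK. Qed.

Lemma extend_eq0 pi u v : ~~ ((u \in U) && (v \in U)) -> extend pi u v = 0.
Proof.
rewrite /extend; case: insubP => // u' uU _; case: insubP => // v' vU _.
by rewrite uU vU.
Qed.

Lemma transport_coupling pi : transport (mu \o val) (nu \o val) pi ->
  coupling mu nu (extend pi).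
Proof.
case=> p0 pr pc.
have e0 u v : 0 <= extend pi u v.
  by rewrite /extend; case: insub => // u'; case: insub.
have rows u : (\esum_(w in [set: V]) (extend pi u w)%:E = (mu u)%:E)%E.
  rewrite esum_fsupport => [|z|z zU]; rewrite ?lee_fin //; last first.
    by rewrite extend_eq0 // negb_and zU orbT.
  rewrite sumEFin; congr _%:E; have [uU|uU] := boolP (u \in U).
    rewrite -[u]/(val [` uU]%fset) -[RHS]pr.
    by apply: eq_bigr => w _; rewrite extendE.
  by rewrite muU // big1 // => w _; rewrite extend_eq0 // negb_and uU.
have cols v : (\esum_(w in [set: V]) (extend pi w v)%:E = (nu v)%:E)%E.
  rewrite esum_fsupport => [|z|z zU]; rewrite ?lee_fin //; last first.
    by rewrite extend_eq0 // negb_and zU.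
  rewrite sumEFin; congr _%:E; have [vU|vU] := boolP (v \in U).
    rewrite -[v]/(val [` vU]%fset) -[RHS]pc.
    by apply: eq_bigr => w _; rewrite extendE.
  by rewrite nuU // big1 // => w _; rewrite extend_eq0 // negb_and vU orbT.
(* The upper bound 1 on an entry comes from its row sum. *)
split=> // u v; rewrite e0 /= (le_trans _ (mu1 u)) // -lee_fin -rows.
exact: (le_esum_term (fun w => (extend pi u w)%:E)).
Qed.

Lemma hdist_ge0 u v : (0 <= hdist R E u v)%E.
Proof.
rewrite /hdist; case: eqP => // _; apply: le_ereal_inf_tmp => _ [p _ <-].
by rewrite lee_fin.
Qed.

(** Infinite distances can occur only off [U], where the coupling is 0; inside, [walkU] makes
    [hdist] a natural number. *)
Lemma coupling_cost pi : coupling mu nu pi ->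
  (\esum_(u in [set: V]) \esum_(v in [set: V])
    (hdist R E u v * (pi u v)%:E))%E =
  (cost c (restr pi))%:E.
Proof.
move=> cpi; have [p01 _ _] := cpi;
have p0 u v : 0 <= pi u v by have /andP[] := p01 u v.
have t0 u v : (0 <= hdist R E u v * (pi u v)%:E)%E.
  by rewrite mule_ge0 ?hdist_ge0 ?lee_fin.
rewrite esum_fsupport => [|u|u uU]; first last.
- by apply: esum1 => v _; rewrite (coupling_eq0 cpi) ?mule0 // negb_and uU.
- by apply: esum_ge0.
rewrite /cost -sumEFin; apply: eq_bigr => u _.
rewrite esum_fsupport => [|v|v vU] //; last first.
  by rewrite (coupling_eq0 cpi) ?mule0 // negb_and vU orbT.
rewrite -sumEFin; apply: eq_bigr => v _.
by have [n walk] := walkU u v; rewrite (hdistE R walk) EFinM.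
Qed.

Lemma wasserstein1_fsupport (M : R) :
  (exists2 pi, transport (mu \o val) (nu \o val) pi & cost c pi = M) ->
  (forall pi, transport (mu \o val) (nu \o val) pi -> M <= cost c pi) ->
  wasserstein1 E mu nu = M%:E.
Proof.
move=> [pi tpi <-] minM; apply/eqP; rewrite eq_le; apply/andP; split.
  apply: ereal_inf_lbound; exists (extend pi); first exact: transport_coupling.
  rewrite coupling_cost; last exact: transport_coupling.
  congr _%:E; apply: eq_bigr => u _; apply: eq_bigr => v _.
  by rewrite /restr extendE.
apply: le_ereal_inf_tmp => _ [rho crho <-]; rewrite coupling_cost // lee_fin.
exact/minM/coupling_transport.
Qed.

End FiniteSupport.

(** * The idleness function *)

Section LocalMetric.
Variables (V : choiceType) (E : hypergraph V) (x y : V).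
Hypotheses (lfE : locally_finite E) (xy : hadjacent E x y).

(** Large enough to carry both measures at every idleness, small enough for all its vertices to be
    connected through [x]. *)
Definition two_balls : {fset V} :=
  (x |` (y |` (sphere E x `|` sphere E y)))%fset.

Lemma two_balls_walk (u v : V) : u \in two_balls -> v \in two_balls ->
  exists n, hwalk E n u v.
Proof.
have near w : w \in two_balls ->
    (exists n, hwalk E n w x) /\ (exists n, hwalk E n x w).
  have yx := hadjacent_sym xy.
  rewrite !inE => /orP[/eqP->|/orP[/eqP->|/orP[]]].
  - by split; exists 0%N; left.
  - by split; exists 1%N; apply: hadjacent_walk.
  - move=> /(in_sphere lfE) wx; split; exists 1%N; apply: hadjacent_walk => //.
    exact: hadjacent_sym.
  - move=> /(in_sphere lfE) wy; split; exists (1 + 1)%N.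
      exact: hwalk_trans (hadjacent_walk wy) (hadjacent_walk yx).
    exact: hwalk_trans (hadjacent_walk xy) (hadjacent_walk (hadjacent_sym wy)).
move=> /near[[m um] _] /near[_ [n vn]].
by exists (m + n)%N; exact: hwalk_trans um vn.
Qed.

Lemma two_balls_l : x \in two_balls. Proof. by rewrite !inE eqxx. Qed.
Lemma two_balls_r : y \in two_balls. Proof. by rewrite !inE eqxx orbT. Qed.

Lemma sphere_two_balls_l : (sphere E x `<=` two_balls)%fset.
Proof. by apply/fsubsetP => z zx; rewrite !inE zx !orbT. Qed.

Lemma sphere_two_balls_r : (sphere E y `<=` two_balls)%fset.
Proof. by apply/fsubsetP => z zy; rewrite !inE zy !orbT. Qed.

End LocalMetric.

Section Idleness.
Variables (R : realType) (V : choiceType) (E : hypergraph V) (r : nat).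
Hypotheses (lfE : locally_finite E) (uE : uniform_hypergraph r E)
  (lE : linear_hypergraph E) (x y : V) (xy : hadjacent E x y).

Lemma sphere_measure (u : V) (uU : u \in two_balls E x y) (alpha : R)
    (z : two_balls E x y) : (sphere E u `<=` two_balls E x y)%fset ->
  rw_measure E alpha u (val z) =
  lazy_walk (fsub (two_balls E x y) (sphere E u)) [` uU]%fset alpha z.
Proof.
move=> sub; rewrite (rw_measureE lfE lE _ _ _ uE) /lazy_walk.
by rewrite card_fsub // in_fsub.
Qed.

Lemma rw_measure_le1 (u z : V) (alpha : R) : 0 <= alpha <= 1 ->
  rw_measure E alpha u z <= 1.
Proof.
move=> /andP[a0 a1]; rewrite (rw_measureE lfE lE _ _ _ uE).
have inv1 : (#|` sphere E u|%:R^-1 : R) <= 1.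
  (* An empty sphere is harmless, as the inverse of 0 is 0. *)
  case: #|` _| => [|n]; first by rewrite invr0.
  by rewrite invf_le1 ?ltr0n // ler1n.
have : alpha * (z == u)%:R <= alpha by case: (z == u); rewrite ?mulr1 ?mulr0.
have a1' : 0 <= 1 - alpha by rewrite subr_ge0.
have : (1 - alpha) / #|` sphere E u|%:R * (z \in sphere E u)%:R <= 1 - alpha.
  have h : (1 - alpha) / #|` sphere E u|%:R <= 1 - alpha by rewrite ler_piMr.
  by case: (z \in _); rewrite ?mulr1 ?mulr0.
lra.
Qed.

Lemma rw_measure_out (u z : V) (alpha : R) : u \in two_balls E x y ->
  (sphere E u `<=` two_balls E x y)%fset -> z \notin two_balls E x y ->
  rw_measure E alpha u z = 0.
Proof.
move=> uU sub zU; rewrite (rw_measureE lfE lE _ _ _ uE).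
have -> : (z == u) = false by apply/negP => /eqP zu; rewrite zu uU in zU.
have -> : (z \in sphere E u) = false.
  by apply/negP => /(fsubsetP sub) h; rewrite h in zU.
by rewrite !mulr0 addr0.
Qed.

Lemma sphere_gt0 (u v : V) : hadjacent E u v -> (0 < #|` sphere E u|)%N.
Proof.
move=> /hadjacent_sym vu; rewrite cardfs_gt0; apply/fset0Pn; exists v.
exact/in_sphere.
Qed.

(** [L] is the least common multiple of the sphere sizes [dx * r.-1] and [dy * r.-1]; the factor
    [r.-1] cancels in the multipliers, leaving [lcmn dx dy %/ dx] and [lcmn dx dy %/ dy]. *)
Lemma wasserstein1_rw_measure :
  let dx := hdegree E x in let dy := hdegree E y in
  let L := (lcmn dx dy * r.-1)%N in
  exists k1 k0 km : int,
    [/\ k1 + km <= k0 + k0,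
      k0 - k1 <= (minn (lcmn dx dy %/ dx) (lcmn dx dy %/ dy))%:Z &
      forall alpha : R, 0 <= alpha <= 1 ->
      wasserstein1 E (rw_measure E alpha x) (rw_measure E alpha y) =
        (max_affine (k1%:~R / L%:R) (k0%:~R / L%:R) (km%:~R / L%:R) alpha)%:E].
Proof.
move=> dx dy L.
have yx := hadjacent_sym xy.
pose U := two_balls E x y.
pose c (u v : U) := hdistn E (val u) (val v).
have walkU (u v : U) : exists n, hwalk E n (val u) (val v).
  exact: (two_balls_walk lfE xy (fsvalP u) (fsvalP v)).
have xU : x \in U := two_balls_l E x y; have yU : y \in U := two_balls_r E x y.
have subx : (sphere E x `<=` U)%fset := sphere_two_balls_l E x y.
have suby : (sphere E y `<=` U)%fset := sphere_two_balls_r E x y.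
have sph u v : v \in sphere E u <-> hadjacent E v u := in_sphere lfE u v.
have cardx := card_sphere lfE lE x uE; have cardy := card_sphere lfE lE y uE.
have := sphere_gt0 xy; rewrite cardx muln_gt0 => /andP[dx0 r0].
have := sphere_gt0 yx; rewrite cardy muln_gt0 => /andP[dy0 _].
have ctri u v w : (c u w <= c u v + c v w)%N.
  have [m uv] := walkU u v; have [n vw] := walkU v w.
  exact: hdistn_triangle uv vw.
have far (u v : U) (w : V) :
    val v = w -> u != v -> u \notin fsub U (sphere E w) ->
    (2 <= c u v)%N /\ (2 <= c v u)%N.
  move=> <- uv; rewrite in_fsub => nin.
  have nadj : ~ hadjacent E (val u) (val v) by move=> /sph h; rewrite h in nin.
  have [m um] := walkU u v; have [n vn] := walkU v u; split.
    exact: hdistn_ge2 um _ nadj.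
  apply: hdistn_ge2 vn _ _; first by rewrite eq_sym.
  by move=> /hadjacent_sym.
have close (u v : U) (w : V) : val v = w -> u \in fsub U (sphere E w) ->
    (c u v <= 1)%N /\ (c v u <= 1)%N.
  move=> <-; rewrite in_fsub => /sph uv.
  by rewrite /c !hadjacent_hdistn //; exact: hadjacent_sym.
have [|||||||||||||||k1 [k0 [km [kmid kgap kcost]]]] :=
  @lazy_transport_cost R U c [` xU]%fset [` yU]%fset (fsub U (sphere E x))
    (fsub U (sphere E y)) (lcmn dx dy %/ dx)%N (lcmn dx dy %/ dy)%N L.
- by move=> u; exact: hdistn_refl.
- exact: ctri.
- exact: hadjacent_hdistn.
- exact: hadjacent_hdistn.
- by rewrite in_fsub; apply/negP => /sph[]; rewrite eqxx.
- by rewrite in_fsub; apply/sph.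
- by rewrite in_fsub; apply/negP => /sph[]; rewrite eqxx.
- by rewrite in_fsub; apply/sph.
- by move=> u /(close u [` xU]%fset x erefl)[].
- by move=> u ux /(far u [` xU]%fset x erefl ux)[].
- by move=> u uy /(far u [` yU]%fset y erefl uy)[].
- by move=> u /(close u [` yU]%fset y erefl)[].
- by rewrite /L muln_gt0 lcmn_gt0 dx0 dy0.
- by rewrite card_fsub // cardx mulnA divnK // dvdn_lcml.
- by rewrite card_fsub // cardy mulnA divnK // dvdn_lcmr.
exists k1, k0, km; split=> // alpha a01.
have [[pi tpi cpi] minpi] := kcost alpha a01.
have ex : rw_measure E alpha x \o val =
    lazy_walk (fsub U (sphere E x)) [` xU]%fset alpha.
  by apply/funext => z; exact: sphere_measure.
have ey : rw_measure E alpha y \o val =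
    lazy_walk (fsub U (sphere E y)) [` yU]%fset alpha.
  by apply/funext => z; exact: sphere_measure.
apply: (wasserstein1_fsupport (U := U)) => //.
- by move=> z; exact: rw_measure_out.
- by move=> z; exact: rw_measure_out.
- by move=> z; exact: rw_measure_le1.
- by exists pi; rewrite ?ex ?ey.
- by move=> rho; rewrite ex ey; exact: minpi.
Qed.

End Idleness.

(** The larger divisor has the smaller quotient. This turns the gap bound into the reciprocal of the
    larger sphere size. *)
Lemma minn_div_maxn m n k :
  (0 < m)%N -> (0 < n)%N -> (m %| k)%N -> (n %| k)%N ->
  (minn (k %/ m) (k %/ n) * maxn m n = k)%N.
Proof.
move=> m0 n0 mk nk; have [mn|nm] := leqP m n.
  by rewrite (minn_idPr _) ?divnK // leq_div2l.
by rewrite (minn_idPl _) ?divnK // leq_div2l // ltnW.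
Qed.
Theorem theorem1p2 (R : realType) (V : choiceType) (E : hypergraph V) (r : nat)
    (lfE : locally_finite E) (sE : simple_hypergraph E)
    (uE : uniform_hypergraph r E) (lE : linear_hypergraph E)
    (x y : V) (xy : hadjacent E x y) :
  let dx := hdegree E x in
  let dy := hdegree E y in
  let kappa := fun alpha : R => fine (ollivier_ricci E x y alpha) in
  (forall alpha : R, 0 <= alpha <= 1 ->
     ollivier_ricci E x y alpha \is a fin_num) /\
  concave_function `[0, 1] kappa /\
  piecewise_linear01 3 kappa /\
  affine_on `[0, ((lcmn dx dy)%:R * (r%:R - 1) + 1)^-1] kappa /\
  affine_on `[((maxn dx dy)%:R * (r%:R - 1) + 1)^-1, 1] kappa /\
  (dx = dy -> piecewise_linear01 2 kappa).
Proof.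
move=> dx dy kappa.
have yx := hadjacent_sym xy.
have := sphere_gt0 lfE xy; rewrite (card_sphere lfE lE x uE) muln_gt0.
case/andP=> dx0 r0.
have := sphere_gt0 lfE yx; rewrite (card_sphere lfE lE y uE) muln_gt0.
case/andP=> dy0 _.
(* Adjacency gives [0 < r.-1], so the predecessor is not truncated. *)
have rE : r%:R - 1 = r.-1%:R :> R.
  by case: r r0 {uE} => // n _; rewrite -natr1 addrK.
rewrite rE -!natrM.
set L := (lcmn dx dy * r.-1)%N; set D := (maxn dx dy * r.-1)%N.
have [k1 [k0 [km [kmid kgap kW]]]] := wasserstein1_rw_measure R lfE uE lE xy.
have ricciE (alpha : R) : 0 <= alpha <= 1 -> ollivier_ricci E x y alpha =
    (1 - max_affine (k1%:~R / L%:R) (k0%:~R / L%:R) (km%:~R / L%:R) alpha)%:E.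
  (* Adjacent vertices are at distance 1, so the curvature is 1 minus a finite transport cost. *)
  move=> a01; rewrite /ollivier_ricci kW // (hdistE R (hadjacent_walk xy)).
  by rewrite hadjacent_hdistn // inve1 mule1 EFinB.
have L0 : (0 < L)%N by rewrite muln_gt0 lcmn_gt0 dx0 dy0.
have mDL : (minn (lcmn dx dy %/ dx) (lcmn dx dy %/ dy) * D = L)%N.
  by rewrite mulnA minn_div_maxn // ?dvdn_lcml ?dvdn_lcmr.
have [] := @idleness_shape R k1 k0 km L D _ L0 mDL kmid kgap kappa.
  by move=> z z01; rewrite /kappa ricciE.
move=> ? ? ? ? two; split; first by move=> z z01; rewrite ricciE.
do 4!split=> //.
(* For equal degrees the lcm and the maximum coincide, hence [L = D]. *)
by move=> dxy; apply: two; rewrite /L /D dxy maxnn (lcmn_idPl _).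
Qed.
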